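(* Let $\mathcal{K}_0=\mathbb{R}^{n_1}_+$, let $\mathcal{K}_i\subseteq\mathbb{R}^{n_2}$, $i\in[1:S]$, be nonempty closed convex cones, and $\bar{\mathcal{K}}:=(\mathcal{K}_0,\dots,\mathcal{K}_S)$. Then $\mathcal{CBC}(\bar{\mathcal{K}})\subseteq\mathcal{CMP}(\bar{\mathcal{K}})$.
   Context: Notation: $[1:S]=\{1,\dots,S\}$; $e_k$ is the $k$-th unit vector. For a closed convex cone $\mathcal{K}\subseteq\mathbb{R}^m$ the set-completely positive cone is $\mathcal{CPP}(\mathcal{K}):=\{\sum_{l=1}^{p}x_lx_l^{\mathsf T} : x_l\in\mathcal{K},\ p\in\mathbb{N}\}$. $[M_i]_{i\in[1:S]}$ denotes an $S$-tuple of symmetric $(n_1+n_2)\times(n_1+n_2)$ matrices $M_i=\begin{pmatrix}X&Z_i^{\mathsf T}\\ Z_i&Y_i\end{pmatrix}$ sharing the same upper-left $n_1\times n_1$ block $X$ (with $Z_i\in\mathbb{R}^{n_2\times n_1}$); such tuples form a vector space $\mathcal{S}^{S,n_1}_{n_1+n_2}$ with componentwise operations. In this space, $$\mathcal{CMP}(\bar{\mathcal{K}}):=\operatorname{conv}\left\{\left[\begin{pmatrix}x\\ y_i\end{pmatrix}\begin{pmatrix}x\\ y_i\end{pmatrix}^{\mathsf T}\right]_{i\in[1:S]} : x\in\mathcal{K}_0,\ y_i\in\mathcal{K}_i,\ i\in[1:S]\right\}.$$ For $k\in[1:n_1]$, $\mathcal{CBC}_k(\bar{\mathcal{K}})$ is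 the set of all $\left[\begin{pmatrix}X&Z_i^{\mathsf T}\\ Z_i&Y_i\end{pmatrix}\right]_{i\in[1:S]}$ for which there are $x\in\mathbb{R}$ and $z_i\in\mathbb{R}^{n_2}$, $i\in[1:S]$, with $$X=x\,e_ke_k^{\mathsf T},\qquad Z_i=z_ie_k^{\mathsf T},\qquad \begin{pmatrix}x&z_i^{\mathsf T}\\ z_i&Y_i\end{pmatrix}\in\mathcal{CPP}(\mathbb{R}_+\times\mathcal{K}_i),\quad i\in[1:S]$$ (here $e_k\in\mathbb{R}^{n_1}$), and $\mathcal{CBC}(\bar{\mathcal{K}}):=\sum_{k=1}^{n_1}\mathcal{CBC}_k(\bar{\mathcal{K}})$ (Minkowski sum). *)

(* Defs.v *)
From HB Require Import structures.
From mathcomp Require Import all_boot all_order all_algebra.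
From mathcomp Require Import all_classical all_reals all_analysis.
Import Order.TTheory GRing.Theory Num.Theory.
Import numFieldNormedType.Exports.

Set Implicit Arguments.
Unset Strict Implicit.
Unset Printing Implicit Defensive.

Local Open Scope classical_set_scope.
Local Open Scope ring_scope.

Definition is_cone (R : realType) (m : nat) (K : set 'cV[R]_m) : Prop :=
  forall (t : R) (x : 'cV[R]_m), 0 <= t -> K x -> K (t *: x).

Definition closed_convex_cone (R : realType) (m : nat)
    (K : set 'cV[R]_m) : Prop :=
  [/\ closed K, convex_set K & is_cone K].

Definition nonneg_orthant (R : realType) (m : nat) : set 'cV[R]_m :=
  [set x | forall j, 0 <= x j ord0].

Definition conv_hull (R : realType) (V : lmodType R) (A : set V) : set V :=
  smallest (@convex_set R V) A.

Definition CPP (R : realType) (m : nat) (K : set 'cV[R]_m) : set 'M[R]_m :=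
  [set A | exists (p : nat) (x : 'I_p -> 'cV[R]_m),
     (forall l, K (x l)) /\ A = \sum_(l < p) x l *m (x l)^T].

(* R_+ x K, with the real coordinate first *)
Definition Rplus_times (R : realType) (n : nat) (K : set 'cV[R]_n) :
    set 'cV[R]_(1 + n) :=
  [set v | exists (a : R) (z : 'cV[R]_n),
     [/\ 0 <= a, K z & v = col_mx a%:M z]].

Definition coupled (R : realType) (S n1 n2 : nat) (X : 'M[R]_n1)
    (Z : 'I_S -> 'M[R]_(n2, n1)) (Y : 'I_S -> 'M[R]_n2) :
    {ffun 'I_S -> 'M[R]_(n1 + n2)} :=
  [ffun i => block_mx X (Z i)^T (Z i) (Y i)].

(* CMP, CBC_k and CBC below are sets in the ambient space of all S-tuples of
   matrices; CMP_sub, CBCk_sub and CBC_sub show that they lie in this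
   subspace, so the hull and the Minkowski sum are those of the subspace. *)
Definition coupled_space (R : realType) (S n1 n2 : nat) :
    set {ffun 'I_S -> 'M[R]_(n1 + n2)} :=
  [set M | exists (X : 'M[R]_n1) (Z : 'I_S -> 'M[R]_(n2, n1))
                  (Y : 'I_S -> 'M[R]_n2),
     [/\ X^T = X, forall i, (Y i)^T = Y i & M = coupled X Z Y]].

Definition CMP (R : realType) (S n1 n2 : nat) (K0 : set 'cV[R]_n1)
    (K : 'I_S -> set 'cV[R]_n2) : set {ffun 'I_S -> 'M[R]_(n1 + n2)} :=
  conv_hull [set M | exists (x : 'cV[R]_n1) (y : 'I_S -> 'cV[R]_n2),
    [/\ K0 x, forall i, K i (y i) &
        M = [ffun i => col_mx x (y i) *m (col_mx x (y i))^T]]].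

Definition unit_vec (R : realType) (n : nat) (k : 'I_n) : 'cV[R]_n :=
  delta_mx k ord0.

(* K_0 does not occur in CBC_k: it is the nonnegative orthant throughout. *)
Definition CBCk (R : realType) (S n1 n2 : nat) (K : 'I_S -> set 'cV[R]_n2)
    (k : 'I_n1) : set {ffun 'I_S -> 'M[R]_(n1 + n2)} :=
  [set M | exists (X : 'M[R]_n1) (Z : 'I_S -> 'M[R]_(n2, n1))
                  (Y : 'I_S -> 'M[R]_n2),
     M = coupled X Z Y /\
     exists (x : R) (z : 'I_S -> 'cV[R]_n2),
       [/\ X = x *: (unit_vec R k *m (unit_vec R k)^T),
           forall i, Z i = z i *m (unit_vec R k)^T &
           forall i, CPP (Rplus_times (K i))
                         (block_mx x%:M (z i)^T (z i) (Y i))]].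

Definition CBC (R : realType) (S n1 n2 : nat) (K : 'I_S -> set 'cV[R]_n2) :
    set {ffun 'I_S -> 'M[R]_(n1 + n2)} :=
  [set M | exists N : 'I_n1 -> {ffun 'I_S -> 'M[R]_(n1 + n2)},
     (forall k, CBCk K k (N k)) /\ M = \sum_(k < n1) N k].

Lemma CPP_sym (R : realType) (m : nat) (K : set 'cV[R]_m) (A : 'M[R]_m) :
  CPP K A -> A^T = A.
Proof.
move=> [p [x [_ ->]]]; rewrite (raddf_sum (@trmx R m m)) /=.
by apply: eq_bigr => l _; rewrite trmx_mul trmxK.
Qed.

Lemma coupled_spaceD (R : realType) (S n1 n2 : nat) (a b : R)
    (M N : {ffun 'I_S -> 'M[R]_(n1 + n2)}) :
  coupled_space M -> coupled_space N -> coupled_space (a *: M + b *: N).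
Proof.
move=> [X [Z [Y [hX hY ->]]]] [X' [Z' [Y' [hX' hY' ->]]]].
exists (a *: X + b *: X'), (fun i => a *: Z i + b *: Z' i).
exists (fun i => a *: Y i + b *: Y' i); split.
- by rewrite linearP /= linearZ /= hX hX'.
- by move=> i; rewrite linearP /= linearZ /= hY hY'.
- by apply/ffunP => i; rewrite !ffunE !scale_block_mx add_block_mx
    linearP /= linearZ.
Qed.

Lemma CMP_sub (R : realType) (S n1 n2 : nat) (K0 : set 'cV[R]_n1)
    (K : 'I_S -> set 'cV[R]_n2) : CMP K0 K `<=` @coupled_space R S n1 n2.
Proof.
apply: smallest_sub.
  by move=> M N l; rewrite !inE; exact: coupled_spaceD.
move=> M [x [y [_ _ ->]]].
exists (x *m x^T), (fun i => y i *m x^T), (fun i => y i *m (y i)^T); split.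
- by rewrite trmx_mul trmxK.
- by move=> i; rewrite trmx_mul trmxK.
- apply/ffunP => i.
  by rewrite !ffunE tr_col_mx mul_col_row trmx_mul trmxK.
Qed.

Lemma CBCk_sub (R : realType) (S n1 n2 : nat) (K : 'I_S -> set 'cV[R]_n2)
    (k : 'I_n1) : CBCk K k `<=` @coupled_space R S n1 n2.
Proof.
move=> M [X [Z [Y [-> [x [z [hX _ hC]]]]]]].
exists X, Z, Y; split => //.
  by rewrite hX linearZ /= trmx_mul trmxK.
by move=> i; have /CPP_sym := hC i; rewrite tr_block_mx => /eq_block_mx[].
Qed.

Lemma CBC_sub (R : realType) (S n1 n2 : nat) (K : 'I_S -> set 'cV[R]_n2) :
  CBC K `<=` @coupled_space R S n1 n2.
Proof.
move=> M [N [hN ->]]; apply: (big_ind (@coupled_space R S n1 n2)).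
- exists 0, (fun=> 0), (fun=> 0); split; rewrite ?trmx0 //.
  by apply/ffunP => i; rewrite !ffunE trmx0 block_mx0.
- by move=> A B hA hB; have := coupled_spaceD 1 1 hA hB; rewrite !scale1r.
- by move=> k _; exact: CBCk_sub (hN k).
Qed.

(* Main.v *)
(* A decomposition of the i-th block of an element of CBC_k is a sum of outer
   products of vectors (a, w) with a >= 0 and w in K_i. The terms with a = 0
   enter CMP as tuples with x = 0 and a single nonzero y_i. The terms with
   a > 0, rescaled to (e_k, w / a) with weights a^2 whose sum x does not depend
   on i, place the rest of the block in the convex hull of the outer products
   of (sqrt x e_k, y), y in K_i. These vectors share their first part, and the
   convex hull of a product is the product of the convex hulls. Finally CMP, the
   hull of a set stable under nonnegative scaling, is closed under sums. *)
Require Import Defs.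
From mathcomp Require Import all_boot all_order all_algebra.
From mathcomp Require Import all_classical all_reals all_analysis.
From mathcomp Require Import ring.
Import Order.TTheory GRing.Theory Num.Theory.

Set Implicit Arguments.
Unset Strict Implicit.
Unset Printing Implicit Defensive.

Local Open Scope classical_set_scope.
Local Open Scope ring_scope.

(** * Convex sets and convex hulls *)

Lemma convex_setP (R : realType) (V : lmodType R) (C : set V) :
  convex_set C <-> forall (t : R) (x y : V), 0 <= t -> t <= 1 ->
    C x -> C y -> C (t *: x + (1 - t) *: y).
Proof.
split=> [cC t x y t0 t1 Cx Cy|cC].
  pose l := @Itv01 R t t0 t1.
  by have := cC x y l; rewrite !inE; apply.
move=> x y l; rewrite !inE => Cx Cy.
by apply: cC.
Qed.

Lemma conv_hull_convex (R : realType) (V : lmodType R) (A : set V) :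
  convex_set (conv_hull A).
Proof.
apply/convex_setP => t x y t0 t1 Ax Ay B [cB AB].
by move/convex_setP: (cB); apply => //; [exact: Ax|exact: Ay].
Qed.

Lemma sub_conv_hull (R : realType) (V : lmodType R) (A : set V) :
  A `<=` conv_hull A.
Proof. exact: sub_gen_smallest. Qed.

(** The preimage of a convex set under a map that preserves convex combinations is convex, so it
    contains the hull of [A] once it contains [A]. *)
Lemma conv_hull_affine (R : realType) (V W : lmodType R) (f : V -> W)
    (A : set V) (B : set W) :
  (forall t x y, f (t *: x + (1 - t) *: y) = t *: f x + (1 - t) *: f y) ->
  (forall x, A x -> conv_hull B (f x)) ->
  forall x, conv_hull A x -> conv_hull B (f x).
Proof.
move=> fD AB; apply: smallest_sub AB.
apply/convex_setP => t x y t0 t1 /= Bx By; rewrite fD.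
by move/convex_setP: (@conv_hull_convex R W B); apply.
Qed.

(** Keeping the total weight as a factor avoids normalising: the total may be zero, and then any
    point of [C] serves as [u]. *)
Lemma convex_weighted_sum (R : realType) (V : lmodType R) (C : set V)
    (I : Type) (r : seq I) (c : I -> R) (v : I -> V) :
  convex_set C -> C !=set0 ->
  (forall i, 0 <= c i) -> (forall i, C (v i)) ->
  exists2 u, C u & \sum_(i <- r) c i *: v i = (\sum_(i <- r) c i) *: u.
Proof.
move=> /convex_setP cC [u0 Cu0] c0 Cv.
elim: r => [|i r [u Cu IH]].
  by exists u0 => //; rewrite !big_nil scale0r.
rewrite !big_cons {}IH.
have s0 : 0 <= \sum_(j <- r) c j by apply: sumr_ge0.
set s := \sum_(j <- r) c j in s0 *.
have [cs0|cs_neq0] := eqVneq (c i + s) 0.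
  move/eqP: cs0; rewrite paddr_eq0 // => /andP[/eqP-> /eqP->].
  by exists u0 => //; rewrite !(scale0r, addr0).
have cs_gt0 : 0 < c i + s by rewrite lt_def cs_neq0 addr_ge0.
(* The barycentre of [v i] and [u] with weights [c i] and [s]. *)
exists ((c i / (c i + s)) *: v i + (1 - c i / (c i + s)) *: u).
  apply: cC => //; first by rewrite divr_ge0 // ltW.
  by rewrite ler_pdivrMr // mul1r lerDl.
rewrite scalerDr !scalerA; congr (_ *: _ + _ *: _); last by field.
by field.
Qed.

Section ConicHull.
Context (R : realType) (V : lmodType R) (A : set V).
Hypothesis AZ : forall (t : R) (x : V), 0 <= t -> A x -> A (t *: x).

Lemma conv_hull_scale (t : R) (x : V) :
  0 <= t -> conv_hull A x -> conv_hull A (t *: x).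
Proof.
move=> t0; apply: (@conv_hull_affine _ _ _ ( *:%R t)) => [s y z|y Ay].
  by rewrite scalerDr !scalerA ![t * _]mulrC.
by apply: sub_conv_hull; exact: AZ.
Qed.

(** A sum is twice a midpoint, so convexity and scaling suffice. *)
Lemma conv_hull_add (x y : V) :
  conv_hull A x -> conv_hull A y -> conv_hull A (x + y).
Proof.
move=> Ax Ay.
have /convex_setP cA := @conv_hull_convex R V A.
suff -> : x + y = 2 *: (2^-1 *: x + (1 - 2^-1) *: y).
  by apply: conv_hull_scale => //; apply: cA => //; rewrite invf_le1 ?ler1n.
rewrite scalerDr !scalerA mulfV ?pnatr_eq0// scale1r.
by rewrite (_ : 2 * _ = 1) ?scale1r //; field.
Qed.
End ConicHull.

(* The coordinates of [M] are moved from [A i] to its hull one at a time: with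
   the other coordinates fixed, the remaining one ranges over a convex set. *)
Lemma conv_hull_prod (R : realType) (V : lmodType R) (I : finType)
    (A : I -> set V) (M : {ffun I -> V}) :
  (forall i, conv_hull (A i) (M i)) ->
  conv_hull [set N : {ffun I -> V} | forall i, A i (N i)] M.
Proof.
move=> hM.
(* Induction on the list [r] of coordinates known only to lie in the hull; the full enumeration
   gives the claim. *)
suff : forall (r : seq I) (N : {ffun I -> V}),
    (forall i, i \in r -> conv_hull (A i) (N i)) ->
    (forall i, i \notin r -> A i (N i)) ->
    conv_hull [set N : {ffun I -> V} | forall i, A i (N i)] N.
  by move/(_ (index_enum I) M); apply=> i; rewrite ?mem_index_enum.
elim=> [|j r IH] N hN aN.
  by apply: sub_conv_hull => i; exact: aN.
(* Off [j] this map is constant, so it preserves convex combinations, though it need not be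
   linear. *)
pose repl w : {ffun I -> V} := [ffun i => if i == j then w else N i].
have -> : N = repl (N j).
  by apply/ffunP => i; rewrite ffunE; case: eqVneq => [->|].
apply: (@conv_hull_affine _ _ _ repl (A j)); last first.
- exact: hN (mem_head _ _).
- move=> w Aw; apply: IH => i ir; rewrite ffunE; case: eqVneq => [->|ij] //.
  + exact: sub_conv_hull.
  + by apply: hN; rewrite inE ir orbT.
  + by apply: aN; rewrite inE negb_or ij.
- move=> t x y; apply/ffunP => i; rewrite !ffunE; case: eqVneq => // _.
  by rewrite -scalerDl addrC subrK scale1r.
Qed.

(** * Decomposition of a single block *)

Lemma sum_block_mx (R : nmodType) (m1 m2 n1 n2 : nat) (I : Type) (r : seq I)
    (A : I -> 'M[R]_(m1, n1)) (B : I -> 'M[R]_(m1, n2))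
    (C : I -> 'M[R]_(m2, n1)) (D : I -> 'M[R]_(m2, n2)) :
  \sum_(i <- r) block_mx (A i) (B i) (C i) (D i) =
  block_mx (\sum_(i <- r) A i) (\sum_(i <- r) B i)
           (\sum_(i <- r) C i) (\sum_(i <- r) D i).
Proof.
elim: r => [|i r IH]; first by rewrite !big_nil block_mx0.
by rewrite !big_cons IH add_block_mx.
Qed.

Lemma outer_col_mx (R : comPzRingType) (m n : nat) (x : 'cV[R]_m)
    (y : 'cV[R]_n) :
  col_mx x y *m (col_mx x y)^T =
  block_mx (x *m x^T) (y *m x^T)^T (y *m x^T) (y *m y^T).
Proof. by rewrite tr_col_mx mul_col_row trmx_mul trmxK. Qed.

(** Outer products are quadratic, so a weight [t] becomes a factor [Num.sqrt t] on the vector. *)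
Lemma outer_scale_sqrt (R : rcfType) (m n : nat) (t : R) (x : 'cV[R]_m)
    (y : 'cV[R]_n) : 0 <= t ->
  col_mx (Num.sqrt t *: x) (Num.sqrt t *: y) *m
    (col_mx (Num.sqrt t *: x) (Num.sqrt t *: y))^T =
  t *: (col_mx x y *m (col_mx x y)^T).
Proof.
move=> t0; rewrite -scale_col_mx linearZ /= -scalemxAl -scalemxAr scalerA.
by rewrite -expr2 sqr_sqrtr.
Qed.

Lemma CPP_Rplus_times (R : realType) (n : nat) (K : set 'cV[R]_n) (x : R)
    (z : 'cV[R]_n) (Y : 'M[R]_n) :
  CPP (Rplus_times K) (block_mx x%:M z^T z Y) ->
  exists (p : nat) (a : 'I_p -> R) (w : 'I_p -> 'cV[R]_n),
    [/\ forall l, 0 <= a l, forall l, K (w l), x = \sum_l a l ^+ 2,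
        z = \sum_l a l *: w l
      & Y = \sum_l w l *m (w l)^T].
Proof.
move=> [p [v [/choice[a /choice[w vP]] E]]].
exists p, a, w; move: E.
have vE l : v l = col_mx (a l)%:M (w l) by case: (vP l).
under eq_bigr do rewrite vE outer_col_mx.
rewrite sum_block_mx => /eq_block_mx[xE _ zE YE]; split=> //.
- by move=> l; case: (vP l).
- by move=> l; case: (vP l).
- move: xE => /matrixP/(_ ord0 ord0); rewrite mxE mulr1n => ->.
  rewrite summxE; apply: eq_bigr => l _.
  by rewrite tr_scalar_mx -scalar_mxM mxE mulr1n expr2.
- rewrite zE; apply: eq_bigr => l _.
  by rewrite tr_scalar_mx mul_mx_scalar.
Qed.

(* [D] collects the terms whose first coordinate vanishes. *)
Lemma CPP_Rplus_times_hull (R : realType) (n m : nat) (K : set 'cV[R]_n)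
    (e : 'cV[R]_m) (x : R) (z : 'cV[R]_n) (Y : 'M[R]_n) :
  K !=set0 -> is_cone K ->
  CPP (Rplus_times K) (block_mx x%:M z^T z Y) ->
  exists Y1 D : 'M[R]_n,
    [/\ Y = Y1 + D, CPP K D &
        conv_hull [set col_mx (Num.sqrt x *: e) y *m
                       (col_mx (Num.sqrt x *: e) y)^T | y in K]
          (block_mx (x *: (e *m e^T)) (z *m e^T)^T (z *m e^T) Y1)].
Proof.
move=> [k0 Kk0] Kcone /CPP_Rplus_times[p [a [w [a0 Kw xE zE YE]]]].
exists (\sum_(l | a l != 0) w l *m (w l)^T).
exists (\sum_(l | a l == 0) w l *m (w l)^T).
split.
- by rewrite YE (bigID (fun l => a l == 0)) addrC.
(* Terms with [a l != 0] become zero vectors, so that the sum runs over all of ['I_p]. *)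
- exists p, (fun l => (a l == 0)%:R *: w l); split=> [l|].
    by apply: Kcone => //; exact: ler0n.
  rewrite big_mkcond; apply: eq_bigr => l _.
  by case: eqP => _; rewrite ?scale1r // scale0r mul0mx.
have x0 : 0 <= x by rewrite xE sumr_ge0 // => l _; exact: sqr_ge0.
(* The first part is [e] itself here; the total weight [x] multiplies this hull at the end, and its
   root then enters the vectors. *)
pose A := [set col_mx e y *m (col_mx e y)^T | y in K].
(* If [a l = 0] then [(a l)^-1 = 0], and [v l] has weight [a l ^+ 2 = 0]. *)
pose v l := col_mx e ((a l)^-1 *: w l) *m (col_mx e ((a l)^-1 *: w l))^T.
have [] := @convex_weighted_sum R _ (conv_hull A) _ (index_enum 'I_p)
  (fun l => a l ^+ 2) v (@conv_hull_convex _ _ A).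
- by eexists; apply: sub_conv_hull; exists k0.
- by move=> l; exact: sqr_ge0.
- move=> l; apply: sub_conv_hull; exists ((a l)^-1 *: w l) => //.
  by apply: Kcone; rewrite ?invr_ge0.
move=> u Au; rewrite -xE => uE.
suff -> : block_mx (x *: (e *m e^T)) (z *m e^T)^T (z *m e^T)
    (\sum_(l | a l != 0) w l *m (w l)^T) = x *: u.
  apply: (@conv_hull_affine _ _ _ ( *:%R x) A) Au => [t b c|_ [y Ky <-]].
    by rewrite scalerDr !scalerA ![x * _]mulrC.
  apply: sub_conv_hull; exists (Num.sqrt x *: y).
    by apply: Kcone => //; exact: sqrtr_ge0.
  exact: outer_scale_sqrt.
rewrite -uE; under [RHS]eq_bigr => l _ do rewrite /v outer_col_mx scale_block_mx.
rewrite sum_block_mx -scaler_suml -xE.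
have zeE : z *m e^T = \sum_l a l ^+ 2 *: ((a l)^-1 *: w l *m e^T).
  rewrite zE mulmx_suml; apply: eq_bigr => l _.
  rewrite -!scalemxAl scalerA.
  (* Both sides vanish when [a l = 0], so the terms of [D] contribute nothing to [z]. *)
  have [->|al0] := eqVneq (a l) 0; first by rewrite expr2 !mul0r.
  by congr (_ *: _); field.
congr block_mx => //.
  by rewrite zeE raddf_sum /=; apply: eq_bigr => l _; rewrite linearZ.
rewrite big_mkcond; apply: eq_bigr => l _ /=.
have [->|al0] := eqVneq (a l) 0; first by rewrite expr2 mul0r scale0r.
rewrite linearZ /= -scalemxAl -scalemxAr !scalerA -[LHS]scale1r.
by congr (_ *: _); field.
Qed.

(** * Sums in [CMP] and the inclusion of each [CBCk] *)

Lemma cone0 (R : realType) (m : nat) (K : set 'cV[R]_m) :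
  K !=set0 -> is_cone K -> K 0.
Proof. by move=> [y Ky] Kcone; rewrite -(scale0r y); exact: Kcone. Qed.

Section CMPOrthant.
Context (R : realType) (S n1 n2 : nat) (K : 'I_S -> set 'cV[R]_n2).
Hypotheses (K_nonempty : forall i, K i !=set0)
  (K_cone : forall i, is_cone (K i)).

Let C : set {ffun 'I_S -> 'M[R]_(n1 + n2)} := CMP (@nonneg_orthant R n1) K.

Let G : set {ffun 'I_S -> 'M[R]_(n1 + n2)} :=
  [set M | exists (x : 'cV[R]_n1) (y : 'I_S -> 'cV[R]_n2),
    [/\ nonneg_orthant x, forall i, K i (y i) &
        M = [ffun i => col_mx x (y i) *m (col_mx x (y i))^T]]].

Let G0 : G 0.
Proof.
exists 0, (fun=> 0); split=> [j|i|]; rewrite ?mxE //; first exact: cone0.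
by apply/ffunP => i; rewrite !ffunE col_mx0 mul0mx.
Qed.

Let GZ (t : R) (M : {ffun 'I_S -> 'M[R]_(n1 + n2)}) :
  0 <= t -> G M -> G (t *: M).
Proof.
move=> t0 [x [y [x0 Ky ->]]].
exists (Num.sqrt t *: x), (fun i => Num.sqrt t *: y i); split.
- by move=> j; rewrite mxE mulr_ge0 ?sqrtr_ge0 //; exact: x0.
- by move=> i; apply: K_cone => //; exact: sqrtr_ge0.
- by apply/ffunP => i; rewrite !ffunE outer_scale_sqrt.
Qed.

Lemma CMP_add (M N : {ffun 'I_S -> 'M[R]_(n1 + n2)}) : C M -> C N -> C (M + N).
Proof. exact: (conv_hull_add GZ). Qed.

Lemma CMP_sum (I : Type) (r : seq I) (F : I -> {ffun 'I_S -> 'M[R]_(n1 + n2)}) :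
  (forall i, C (F i)) -> C (\sum_(i <- r) F i).
Proof.
move=> CF; apply: (big_ind C) => //; first exact: sub_conv_hull.
exact: CMP_add.
Qed.

(** With [x = 0] the coupling through the shared block is trivial, and [y j = 0] is allowed for
    [j != i], so each outer product from [K i] yields a generator supported at [i]. *)
Lemma CMP_single i (D : 'M[R]_n2) : CPP (K i) D ->
  C [ffun j => if j == i then block_mx 0 0 0 D else 0].
Proof.
move=> [p [w [Kw ->]]].
suff -> : [ffun j => if j == i then block_mx 0 0 0 (\sum_l w l *m (w l)^T) else 0]
  = \sum_l [ffun j => if j == i then block_mx 0 0 0 (w l *m (w l)^T) else 0]
  :> {ffun 'I_S -> 'M[R]_(n1 + n2)}.
  apply: CMP_sum => l; apply: sub_conv_hull.
  exists 0, (fun j => if j == i then w l else 0); split=> [j|j|].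
  - by rewrite mxE.
  - by have [->|_] := eqVneq j i; [exact: Kw | exact: cone0].
  - apply/ffunP => j; rewrite !ffunE outer_col_mx.
    by case: eqP => _; rewrite !(mul0mx, trmx0, mulmx0, block_mx0).
apply/ffunP => j; rewrite sum_ffunE !ffunE; under [RHS]eq_bigr do rewrite ffunE.
by case: eqP => _; rewrite ?sum_block_mx !big1_eq.
Qed.

Lemma CBCk_sub_CMP (k : 'I_n1) : CBCk K k `<=` C.
Proof.
move=> _ [X [Z [Y [-> [x [z [-> ZE YP]]]]]]].
have /choice[Y1 /choice[D YD]] i :=
  CPP_Rplus_times_hull (unit_vec R k) (K_nonempty i) (@K_cone i) (YP i).
(* [M1] carries the shared block; the remainders [D i] are added one index at a time. *)
pose M1 := coupled (x *: (unit_vec R k *m (unit_vec R k)^T)) Z Y1.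
have -> : coupled (x *: (unit_vec R k *m (unit_vec R k)^T)) Z Y =
  M1 + \sum_i [ffun j => if j == i then block_mx 0 0 0 (D i) else 0].
  apply/ffunP => j; rewrite !ffunE sum_ffunE.
  under eq_bigr do rewrite ffunE.
  rewrite -big_mkcond (big_pred1 j) => [|i]; last exact: eq_sym.
  by rewrite add_block_mx !addr0; have [-> _ _] := YD j.
apply: CMP_add; last first.
  by apply: CMP_sum => i; have [_ Di _] := YD i; exact: CMP_single.
pose v := Num.sqrt x *: unit_vec R k.
pose A i := [set col_mx v y *m (col_mx v y)^T | y in K i].
have hM1 : conv_hull [set N : {ffun _} | forall i, A i (N i)] M1.
  by apply: (conv_hull_prod (A := A)) => i; rewrite ffunE ZE; have [] := YD i.
(* The vector [v] is the same for all [i], so independent choices of [y] in the sets [K i] form a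
   single generator of [CMP]. *)
apply: (conv_hull_affine (f := id) _ _ hM1) => // N AN.
have /choice[y yN] i : exists y, K i y /\ col_mx v y *m (col_mx v y)^T = N i.
  by have [y] := AN i; exists y.
apply: sub_conv_hull; exists v, y; split.
- by move=> j; rewrite !mxE mulr_ge0 ?sqrtr_ge0 ?ler0n.
- by move=> i; case: (yN i).
- by apply/ffunP => i; rewrite ffunE; case: (yN i) => _ <-.
Qed.
End CMPOrthant.

Theorem theorem12 (R : realType) (S n1 n2 : nat)
    (K : 'I_S -> set 'cV[R]_n2)
    (K_nonempty : forall i, K i !=set0)
    (K_cone : forall i, closed_convex_cone (K i)) :
  @CBC R S n1 n2 K `<=` CMP (@nonneg_orthant R n1) K.
Proof.
have cK i : is_cone (K i) by case: (K_cone i).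
move=> _ [N [CN ->]]; apply: CMP_sum => // k.
exact: CBCk_sub_CMP (CN k).
Qed.
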